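(* Let $\Gamma_1,\Gamma_2$ be arbitrary sets, let $w_i:\Gamma_i\to(0,\infty)$, $i=1,2$, be arbitrary functions, and let $1<p,r<\infty$. If $|\Gamma_1|\neq|\Gamma_2|$, then $\ell^{p,\infty}(\Gamma_1,w_1)$ is not isomorphic to $\ell^{r,\infty}(\Gamma_2,w_2)$.
   Context: For $1<p<\infty$, a set $\Gamma$ and $w:\Gamma\to(0,\infty)$, $\ell^{p,\infty}(\Gamma,w)$ is the space of all $x:\Gamma\to\mathbb{R}$ with $\|x\|=\sup_{c>0}c\,(\mu\{|x|>c\})^{1/p}<\infty$, where $\mu(A)=\sum_{\gamma\in A}w(\gamma)$ for $A\subseteq\Gamma$. This expression is equivalent to a norm under which the space is a Banach space. ''Isomorphic'' means linearly homeomorphic. $|A|$ denotes the cardinality of $A$. *)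

(* Defs.v *)
From HB Require Import structures.
From mathcomp Require Import all_boot all_order all_algebra.
From mathcomp Require Import all_classical all_reals all_analysis.
From mathcomp Require Import lra.

Set Implicit Arguments.
Unset Strict Implicit.
Unset Printing Implicit Defensive.

Import Order.TTheory GRing.Theory Num.Theory.
Import numFieldNormedType.Exports.

Local Open Scope classical_set_scope.
Local Open Scope ring_scope.

Definition weight_measure {R : realType} {G : choiceType} (w : G -> {posnum R})
    (A : set G) : \bar R :=
  (\esum_(g in A) ((w g)%:num)%:E)%E.

(* The quasi-norm is extended-real valued: a level set may have infinite
   measure, and (+oo) `^ p^-1 = +oo since p != 0. *)
Definition weakl_norm {R : realType} {G : choiceType} (w : G -> {posnum R})
    (p : R) (x : G -> R) : \bar R :=
  ereal_sup [set (c%:E * weight_measure w [set g | (c < `|x g|)%R] `^ p^-1)%E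
            | c in [set c : R | 0 < c]].

Section QuasiNorm.
Context {R : realType} {G : choiceType} (w : G -> {posnum R}) (p : R).
Implicit Types (A B : set G) (x y : G -> R).
Local Notation mu := (weight_measure w).
Local Notation N := (weakl_norm w p).

Lemma weight_measure_ge0 A : (0 <= mu A)%E.
Proof. by apply: esum_ge0 => g _; rewrite lee_fin. Qed.

Lemma le_weight_measure A B : A `<=` B -> (mu A <= mu B)%E.
Proof.
move=> AB; apply: ereal_sup_le => _ [X [fX XA] <-].
by exists X => //; split => // g /XA/AB.
Qed.

Lemma weight_measureU A B : (mu (A `|` B) <= mu A + mu B)%E.
Proof.
rewrite /weight_measure (esumID A) => [|g _]; last by rewrite lee_fin.
by apply: leeD; apply: le_weight_measure => g [] // [].
Qed.

Lemma weakl_norm_ge c x : 0 < c ->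
  (c%:E * mu [set g | (c < `|x g|)%R] `^ p^-1 <= N x)%E.
Proof. by move=> c0; apply: ereal_sup_ubound; exists c. Qed.

Lemma weakl_norm_ge0 x : (0 <= N x)%E.
Proof.
apply: le_trans (@weakl_norm_ge 1 x ltr01).
by rewrite mul1e poweR_ge0.
Qed.

Lemma weakl_normN x : N (- x) = N x.
Proof.
by congr ereal_sup; apply: eq_imagel => c _; congr (_ * mu _ `^ _)%E;
   apply/seteqP; split=> g /=; rewrite [(- x) g]/(- x g) normrN.
Qed.

Hypothesis p1 : 1 < p.

Let p0 : 0 < p. Proof. exact: lt_trans p1. Qed.
Let ip0 : 0 < p^-1. Proof. by rewrite invr_gt0. Qed.

Lemma weakl_norm0 : N 0 = 0%E.
Proof.
apply/eqP; rewrite eq_le weakl_norm_ge0 andbT.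
apply: ge_ereal_sup => _ [c c0 <-].
rewrite (_ : [set g | _] = set0); last first.
  by apply/seteqP; split => // g /=; rewrite normr0 ltNge ltW.
by rewrite /weight_measure esum_set0 poweR0r ?mule0// gt_eqF.
Qed.

Let le_mupow (a b : \bar R) : (0 <= a)%E -> (a <= b)%E ->
  (a `^ p^-1 <= b `^ p^-1)%E.
Proof.
move=> a0 ab; apply: gt0_ler_poweR; rewrite ?in_itv/= ?leey ?andbT//.
- exact: ltW.
- exact: le_trans ab.
Qed.

Lemma weakl_normD x y : (N (x + y)%R <= 4%:E * maxe (N x) (N y))%E.
Proof.
apply: ge_ereal_sup => _ [c c0 <-].
rewrite /= in c0.
have c20 : 0 < c / 2 by lra.
pose A := [set g | c / 2 < `|x g|]; pose B := [set g | c / 2 < `|y g|].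
have leAB : (mu [set g | (c < `|(x + y)%R g|)%R] <= 2%:E * maxe (mu A) (mu B))%E.
  apply: (@le_trans _ _ (mu (A `|` B))).
    apply: le_weight_measure => g /= cxy.
    have [|xg] := ltP (c / 2) `|x g|; [by left|right].
    rewrite /B/=; have := ler_normD (x g) (y g); move: cxy.
    rewrite -[(x + y) g]/(x g + y g).
    by move=> /lt_le_trans /[apply]; lra.
  apply: (le_trans (weight_measureU A B)).
  rewrite -[2]/(1 + 1) EFinD ge0_muleDl// mul1e.
  by apply: leeD; rewrite le_max lexx ?orbT.
have main C z : ((c / 2)%:E * mu C `^ p^-1 <= N z)%E ->
    (c%:E * (2%:E * mu C) `^ p^-1 <= 4%:E * N z)%E.
  move=> Cz; apply: (@le_trans _ _ (4%:E * ((c / 2)%:E * mu C `^ p^-1))%E); last first.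
    exact: lee_wpmul2l.
  rewrite poweRM ?weight_measure_ge0// !muleA -EFinM; apply: lee_wpmul2r.
    exact: poweR_ge0.
  rewrite -EFinM lee_fin (_ : 4 * (c / 2) = c * 2); last by lra.
  by rewrite ler_pM2l// ler1_powR ?ler1n// invf_le1// ltW.
have zN z : (N z <= maxe (N x) (N y))%E ->
    (4%:E * N z <= 4%:E * maxe (N x) (N y))%E by exact: lee_wpmul2l.
apply: (@le_trans _ _ (c%:E * (2%:E * maxe (mu A) (mu B)) `^ p^-1)%E).
  apply: lee_wpmul2l; first by rewrite lee_fin ltW.
  by apply: le_mupow => //; exact: weight_measure_ge0.
have [AB|BA] := leP (mu A) (mu B).
- apply: le_trans (zN y _); last by rewrite le_max lexx orbT.
  by apply: main; exact: weakl_norm_ge.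
- apply: le_trans (zN x _); last by rewrite le_max lexx.
  by apply: main; exact: weakl_norm_ge.
Qed.

Lemma weakl_normZ a x : (N (a *: x)%R <= `|a|%:E * N x)%E.
Proof.
have [->|a0] := eqVneq a 0.
  by rewrite scale0r weakl_norm0 normr0 mul0e.
have na0 : 0 < `|a| by rewrite normr_gt0.
apply: ge_ereal_sup => _ [c c0 <-].
rewrite -[c in (c%:E * _)%E](@divfK _ `|a|) ?gt_eqF// mulrC EFinM -muleA.
apply: lee_wpmul2l => //.
rewrite (_ : [set g | _] = [set g | c / `|a| < `|x g|]).
  by apply: weakl_norm_ge; rewrite divr_gt0.
by apply/seteqP; split=> g /=; rewrite normrM ltr_pdivrMr// mulrC.
Qed.

End QuasiNorm.

Section WeakLp.
Context {R : realType} {G : choiceType} (w : G -> {posnum R}) (p : R)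
  (p1 : 1 < p).

(* The proof of 1 < p is a parameter so that closure under addition, hence the
   module structure, can be inferred from the type alone. *)
Definition finite_weakl_norm of 1 < p : {pred (G -> R)} :=
  mem [set x | (weakl_norm w p x < +oo)%E].

Record weaklType := WeakL {
  weakl_fun :> G -> R ;
  weakl_finite : weakl_fun \in finite_weakl_norm p1 }.

HB.instance Definition _ := [isSub for weakl_fun].
HB.instance Definition _ := [Choice of weaklType by <:].

Lemma weakl_submod_closed : submod_closed (finite_weakl_norm p1).
Proof.
split; first by rewrite inE/= weakl_norm0.
move=> a x y; rewrite !inE/= => xoo yoo.
apply: le_lt_trans (weakl_normD w p1 _ _) _.
rewrite lte_mul_pinfty// gt_max yoo andbT.
apply: le_lt_trans (weakl_normZ w p1 _ _) _.
by rewrite lte_mul_pinfty.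
Qed.

HB.instance Definition _ :=
  GRing.isSubmodClosed.Build _ _ (finite_weakl_norm p1) weakl_submod_closed.
HB.instance Definition _ := [SubChoice_isSubLmodule of weaklType by <:].

(* The quasi-norm need not satisfy the triangle inequality, so the topology is
   given by the uniformity of quasi-norm balls; it is also the topology of any
   norm equivalent to the quasi-norm. *)
Definition weakl_ball (e : R) : set (weaklType * weaklType) :=
  [set xy : weaklType * weaklType | (weakl_norm w p (xy.1 - xy.2)%R < e%:E)%E].

Definition weakl_entourage : set_system (weaklType * weaklType) :=
  filter_from [set e : R | 0 < e] weakl_ball.

Let entourage_filter : Filter weakl_entourage.
Proof.
apply: filter_from_filter; first by exists 1 => /=.
move=> d e /= d0 e0; exists (Num.min d e); first by rewrite /= lt_min d0.
by move=> xy; rewrite /weakl_ball/= EFin_min lt_min => /andP[].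
Qed.

Let entourage_diagonal A : weakl_entourage A -> diagonal `<=` A.
Proof.
move=> [e /= e0 eA] [x y] xy; apply: eA.
by rewrite /weakl_ball/= (xy : x = y) subrr weakl_norm0 // lte_fin.
Qed.

Let entourage_inv A : weakl_entourage A -> weakl_entourage A^-1%relation.
Proof.
move=> [e /= e0 eA]; exists e => // -[x y] /= xy; apply: eA.
by rewrite /weakl_ball/= -opprB weakl_normN.
Qed.

Let entourage_split A : weakl_entourage A ->
  exists2 B, weakl_entourage B & (B \; B)%relation `<=` A.
Proof.
move=> [e /= e0 eA]; exists (weakl_ball (e / 4)).
  by exists (e / 4) => //=; lra.
move=> [x y] /= [z /= xz zy]; apply: eA; rewrite /weakl_ball/=.
rewrite (_ : _ - _ = ((x : G -> R) - (z : G -> R)) + ((z : G -> R) - (y : G -> R)));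
  last by rewrite addrA subrK.
apply: le_lt_trans (weakl_normD w p1 _ _) _.
rewrite (_ : e = 4 * (e / 4)); last by lra.
by rewrite EFinM lte_pmul2l// gt_max xz.
Qed.

HB.instance Definition _ := isUniform.Build weaklType
  entourage_filter entourage_diagonal entourage_inv entourage_split.

End WeakLp.

Definition isomorphic {R : numDomainType} (E F : preTopologicalLmodType R) :=
  exists (f : {linear E -> F}) (g : F -> E),
    [/\ cancel f g, cancel g f, continuous f & continuous g].

(* Main.v *)
From HB Require Import structures.
Require Import Defs.
From mathcomp Require Import all_boot all_order all_algebra.
From mathcomp Require Import finmap.
From mathcomp Require Import all_classical all_reals all_analysis.
From mathcomp Require Import ring.

Import Order.TTheory GRing.Theory Num.Theory.
Import numFieldNormedType.Exports.

(** A sequence space of this kind determines the cardinality of its index set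
because an injective continuous linear map T from l^{p,oo}(G1, w1) to
l^{r,oo}(G2, w2) forces |G1| <= |G2|; applying this to an isomorphism and to its
inverse, Cantor-Bernstein gives |G1| = |G2|.

If G2 is finite, this is a dimension count: the unit vectors of G1 are linearly
independent and T maps them into a space of dimension |G2|.

If G2 is infinite, consider the coordinate functionals phi_h = (T _)(h) for
h in G2. The key fact ([countable_support]) is that a continuous functional phi
is nonzero at only countably many unit vectors e_g, because p > 1. Indeed a sum
of N signed unit vectors with weights at most M has norm at most (N M)^{1/p},
whereas, for suitable signs, the value of phi on it is at least N e if
|phi(e_g)| >= e for each of them.
Since N^{1/p} = o(N), only finitely many g satisfy w(g) <= M and |phi(e_g)| >= e,
and G1 is covered by countably many such conditions as far as phi(e_g) != 0.
As T is injective, every T(e_g) has a nonzero coordinate h, so the countable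
supports of the functionals phi_h cover G1. Hence |G1| <= |G2 x nat|, which
is |G2| for infinite G2 ([infinite_card_prod_nat], by Zorn's lemma). *)

Set Implicit Arguments.
Unset Strict Implicit.
Unset Printing Implicit Defensive.

Local Open Scope classical_set_scope.
Local Open Scope ring_scope.

(** * Infinite cardinals absorb a countable factor *)

Lemma injective_card_le (T U : Type) (f : T -> U) :
  injective f -> ([set: T] #<= [set: U])%card.
Proof.
move=> finj; suff [g] : $|{injfun [set: T] >-> [set: U]}| by exact: inj_card_le.
by apply/injfunPex; exists f => // x y _ _ /finj.
Qed.

(** Zorn's lemma on families of injective sequences with disjoint ranges: were
the part missed by a maximal family infinite, it would contain one more
sequence. *)
Lemma max_disjoint_sequences (T : Type) : exists S : set (nat -> T),
  [/\ forall f, S f -> injective f,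
      forall f g m n, S f -> S g -> f m = g n -> f = g &
      finite_set (~` [set x | exists2 f, S f & exists n, f n = x])].
Proof.
pose P (S : set (nat -> T)) := (forall f, S f -> injective f) /\
  (forall f g m n, S f -> S g -> f m = g n -> f = g).
have [F FP totF|S [[Sinj Sdisj] Smax]] := @Zorn_bigcup _ P.
  split=> [f [X FX Xf]|f g m n [X FX Xf] [Y FY Yg]]; first exact: (FP X FX).1.
  have [XY|YX] := totF _ _ FX FY.
    by apply: (FP Y FY).2 => //; exact: XY.
  by apply: (FP X FX).2 => //; exact: YX.
exists S; split => //; apply: contrapT => /infiniteP/card_leP[h].
set C := ~` _ in h.
pose k n : T := val (h (SigSub (mem_set (I : [set: nat] n)))).
have kC n : C (k n) by apply: set_mem; exact: valP.
have kinj : injective k.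
  move=> m n /val_inj/inj mn.
  by have := mn (in_setT _) (in_setT _) => /(congr1 val).
have kS : ~ S k by move=> Sk; apply: (kC 0%N); exists k => //; exists 0%N.
apply: (Smax (S `|` [set k])).
  by split; [exact: subsetUl | move=> kSS; apply/kS/kSS; right].
split=> [f [/Sinj//|->//]|f g m n [Sf|->] [Sg|->] // fg].
- exact: Sdisj fg.
- by have := kC n; case; exists f => //; exists m.
- by have := kC m; case; exists g => //; exists n.
Qed.

(** Disjoint sequences decompose T, up to a finite remainder, into copies of
nat; each copy absorbs its product with nat through a pairing of natural numbers,
and the remainder is sent to unused terms of one of the sequences. *)
Lemma infinite_card_prod_nat (T : Type) : infinite_set [set: T] ->
  ([set: T * nat] #<= [set: T])%card.
Proof.
move=> Tinf; have [S [Sinj Sdisj]] := max_disjoint_sequences T.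
set U := [set x | _] => Cfin.
have [f0 Sf0] : exists f0, S f0.
  apply: contrapT => /forallNP S0; apply: Tinf.
  by rewrite (_ : setT = ~` U)//; apply/seteqP; split=> // x _ [f /S0].
have /countable_injP[idx idxinj] := finite_set_countable Cfin.
have /choice[q qP] x : exists q : (nat -> T) * nat, U x -> S q.1 /\ q.1 q.2 = x.
  have [[f Sf [n fn]]|Ux] := pselect (U x); first by exists (f, n).
  by exists (f0, 0%N) => /Ux.
(* The boolean tag keeps the codes of the finite remainder apart from those of
   the terms of f0. *)
pose code (xk : T * nat) :=
  if `[< U xk.1 >] then (q xk.1).1 (choice.pickle (true, (q xk.1).2, xk.2))
  else f0 (choice.pickle (false, idx xk.1, xk.2)).
apply: (@injective_card_le _ _ code) => -[x k] [y l]; rewrite /code/=.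
case: asboolP => [/[dup] Ux /qP[Sx xE]|Ux]; case: asboolP => [/[dup] Uy /qP[Sy yE]|Uy] E.
- have qxy := Sdisj _ _ _ _ Sx Sy E; rewrite qxy in E.
  have /(pcan_inj choice.pickleK) [nxy ->] := Sinj _ Sy _ _ E.
  by rewrite -xE -yE qxy nxy.
- have qxy := Sdisj _ _ _ _ Sx Sf0 E; rewrite qxy in E.
  by have /(pcan_inj choice.pickleK) := Sinj _ Sf0 _ _ E.
- have qxy := Sdisj _ _ _ _ Sf0 Sy E; rewrite -qxy in E.
  by have /(pcan_inj choice.pickleK) := Sinj _ Sf0 _ _ E.
- have /(pcan_inj choice.pickleK) [ixy ->] := Sinj _ Sf0 _ _ E.
  by congr pair; apply: idxinj => //; exact: mem_set.
Qed.

(** * Functionals on the weak l^p space *)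

Section WeakNorm.
Context {R : realType} {G : choiceType} (w : G -> {posnum R}) (p : R).
Hypothesis p1 : 1 < p.

Let p0 : 0 < p. Proof. exact: lt_trans p1. Qed.
Let ip0 : 0 < p^-1. Proof. by rewrite invr_gt0. Qed.

Lemma weakl_norm_le (A : {fset G}) (M t : R) (x : G -> R) :
  0 <= t -> 0 <= M ->
  (forall g, g \in A -> (w g)%:num <= M) ->
  (forall g, `|x g| <= t) -> (forall g, g \notin A -> x g = 0) ->
  (weakl_norm w p x <= (t * (#|` A|%fset%:R * M) `^ p^-1)%:E)%E.
Proof.
move=> t0 M0 wM xt xA; apply: ge_ereal_sup => _ [c /= c0 <-].
have AM0 : 0 <= #|` A|%fset%:R * M by rewrite mulr_ge0.
have [tc|ct] := leP t c.
  rewrite (_ : [set g | _] = set0); last first.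
    apply/seteqP; split=> // g /=.
    by rewrite ltNge (le_trans (xt g) tc).
  rewrite /weight_measure esum_set0 poweR0r ?gt_eqF// mule0.
  by rewrite lee_fin mulr_ge0 ?powR_ge0.
have muA : (weight_measure w [set g | (c < `|x g|)%R] <=
    (#|` A|%fset%:R * M)%:E)%E.
  apply: (@le_trans _ _ (weight_measure w [set` A])).
    apply: le_weight_measure => g /= cx; apply: contraTT cx => /xA ->.
    by rewrite normr0 -leNgt ltW.
  rewrite /weight_measure esum_fset// ?fsbig_finite//= set_fsetK.
  rewrite sumEFin lee_fin.
  rewrite mulr_natl -[leRHS]iter_addr_0 -count_predT -big_const_seq.
  by rewrite big_seq [leRHS]big_seq; apply: ler_sum => g /wM.
rewrite EFinM -poweR_EFin; apply: lee_pmul.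
- by rewrite lee_fin ltW.
- exact: poweR_ge0.
- by rewrite lee_fin ltW.
- apply: gt0_ler_poweR; rewrite ?in_itv/= ?leey ?andbT ?lee_fin//.
    exact: ltW.
  exact: weight_measure_ge0.
Qed.

(** Any level c < |x g| gives a lower bound of the norm, since the level set
contains g; the level |x g| / 2 is good enough for continuity of coordinates. *)
Lemma coord_le_weakl_norm (x : G -> R) g :
  ((`|x g| / 2 * (w g)%:num `^ p^-1)%:E <= weakl_norm w p x)%E.
Proof.
have [->|xg0] := eqVneq (x g) 0.
  by rewrite normr0 !mul0r weakl_norm_ge0.
have xg2 : 0 < `|x g| / 2 by rewrite divr_gt0// normr_gt0.
apply: le_trans (weakl_norm_ge w p x xg2).
rewrite EFinM -poweR_EFin; apply: lee_wpmul2l; first by rewrite lee_fin ltW.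
apply: gt0_ler_poweR; rewrite ?in_itv/= ?leey ?andbT ?lee_fin//.
- exact: ltW.
- exact: weight_measure_ge0.
rewrite -(@esum_set1 _ _ g (fun g => ((w g)%:num)%:E))//.
apply: le_weight_measure => _ /= ->.
by rewrite ltr_pdivrMr// ltr_pMr ?normr_gt0// ltr1n.
Qed.

Let X := weaklType w p1.

Lemma unit_vector_finite g :
  (fun h => (h == g)%:R) \in finite_weakl_norm w p1.
Proof.
rewrite inE/=.
apply: (le_lt_trans (@weakl_norm_le [fset g]%fset (w g)%:num 1 _ _ _ _ _ _)).
all: rewrite ?ltry//.
- by move=> h /fset1P ->.
- by move=> h; case: eqP; rewrite ?normr1 ?normr0.
- by move=> h /fset1P/eqP; case: eqP.
Qed.

Definition unit_vector g : X := WeakL (unit_vector_finite g).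

Definition coord (g : G) (x : X) : R := x g.

Lemma coord_is_linear g : scalar (coord g).
Proof. by []. Qed.

HB.instance Definition _ g :=
  GRing.isLinear.Build R X R *%R (coord g) (coord_is_linear g).

Lemma weakl_nbhsP (x : X) (A : set X) : nbhs x A <->
  exists2 e : R, 0 < e &
    forall y : X, (weakl_norm w p (x - y)%R < e%:E)%E -> A y.
Proof.
rewrite -nbhs_entourageE; split=> [[E [e /= e0 eE] EA]|[e e0 eA]].
  by exists e => // y xy; apply: EA; apply/xsectionP; exact: eE.
exists (weakl_ball e); first by exists e.
by move=> y /xsectionP; exact: eA.
Qed.

Lemma continuous_coord g : continuous (coord g).
Proof.
move=> x; have FF := @nbhs_filter X x.
apply/(@cvgrPdist_lt R R^o _ _ FF) => e e0; apply/weakl_nbhsP.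
have wp0 : 0 < (w g)%:num `^ p^-1 by rewrite powR_gt0.
exists (e / 2 * (w g)%:num `^ p^-1); first by rewrite !mulr_gt0// invr_gt0.
move=> y /(le_lt_trans (coord_le_weakl_norm _ g)); rewrite lte_fin.
by rewrite ltr_pM2r// ltr_pM2r.
Qed.

Lemma continuous_scalar_bounded (phi : {scalar X}) : continuous (phi : X -> R) ->
  exists2 d : R, 0 < d &
    forall x : X, (weakl_norm w p x < d%:E)%E -> `|phi x| < 1.
Proof.
move=> /(_ 0)/cvgrPdist_lt/(_ 1 ltr01)/weakl_nbhsP[d d0 dP].
exists d => // x xd; have := dP x; rewrite sub0r weakl_normN => /(_ xd).
by rewrite raddf0 sub0r normrN.
Qed.

(** The norm of a signed sum of N unit vectors of bounded weight is O(N^{1/p}),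
but phi would be at least N e on it for the right choice of signs. *)
Lemma finite_large_values (phi : {scalar X}) (M e : R) :
  continuous (phi : X -> R) -> 0 < e ->
  finite_set [set g | (w g)%:num <= M /\ e <= `|phi (unit_vector g)|].
Proof.
move=> /continuous_scalar_bounded[d d0 phid] e0; apply: contrapT => Sinf.
have [g0 [gM _]] : [set g | (w g)%:num <= M /\ e <= `|phi (unit_vector g)|] !=set0.
  exact: infinite_setN0.
have M0 : 0 < M by apply: lt_le_trans gM.
(* A set A of N such indices will lead to a * N < (N * M)^{1/p}, which is
   N^{p - 1} < M / a^p: the integer n makes N too large for this. *)
pose a := d / 2 * e.
have a0 : 0 < a by rewrite !mulr_gt0// invr_gt0.
pose n := Num.truncn ((M / a `^ p) `^ (p - 1)^-1).
have [A AS An] := @infinite_set_fset _ _ n.+1 Sinf.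
pose N : R := #|` A|%fset%:R.
have nN : (M / a `^ p) `^ (p - 1)^-1 < N.
  by apply: (lt_le_trans (truncnS_gt _)); rewrite ler_nat.
have N0 : 0 < N by rewrite ltr0n (leq_ltn_trans _ An).
have NM0 : 0 < (N * M) `^ p^-1 by rewrite powR_gt0// mulr_gt0.
(* The vector x below then has norm at most d / 2. *)
pose t := d / 2 / (N * M) `^ p^-1.
have t0 : 0 < t by rewrite !divr_gt0.
pose x : X := \sum_(g <- A) (t * Num.sg (phi (unit_vector g))) *: unit_vector g.
have xE g : (x : G -> R) g = (g \in A)%:R * (t * Num.sg (phi (unit_vector g))).
  pose c h := t * Num.sg (phi (unit_vector h)).
  rewrite -[LHS]/(coord g x) raddf_sum (eq_bigr (fun h => c h * (g == h)%:R))//.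
  have [gA|gA] := boolP (g \in A).
    rewrite (big_fsetD1 g)//= big_seq big1 => [|h].
      by rewrite eqxx addr0 mul1r mulr1.
    by rewrite in_fsetD1 eq_sym => /andP[/negbTE -> _]; rewrite mulr0.
  rewrite big_seq big1 ?mul0r// => h hA.
  case: eqP => [gh|]; last by rewrite mulr0.
  by rewrite gh hA in gA.
have phix : phi x = t * \sum_(g <- A) `|phi (unit_vector g)|.
  rewrite raddf_sum/= mulr_sumr; apply: eq_bigr => g _.
  by rewrite linearZ/= -mulrA -normrEsg.
have : `|phi x| < 1.
  apply: phid; apply: (@le_lt_trans _ _ (d / 2)%:E); last first.
    by rewrite lte_fin ltr_pdivrMr// ltr_pMr// ltr1n.
  rewrite (_ : d / 2 = t * (N * M) `^ p^-1); last by rewrite divfK ?gt_eqF.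
  apply: weakl_norm_le; rewrite ?ltW//.
  - by move=> g /AS[].
  - move=> g; rewrite xE mulrCA normrM gtr0_norm// ler_piMr//; first exact: ltW.
    by rewrite normrM normr_nat normr_sg -natrM lern1 mulnb leq_b1.
  - by move=> g /negbTE; rewrite xE => ->; rewrite mul0r.
apply/negP; rewrite -leNgt phix ger0_norm; last first.
  by rewrite mulr_ge0 ?sumr_ge0// ltW.
have eN : N * e <= \sum_(g <- A) `|phi (unit_vector g)|.
  rewrite mulr_natl -[leLHS]iter_addr_0 -count_predT -big_const_seq.
  by rewrite big_seq [leRHS]big_seq; apply: ler_sum => g /AS[].
apply: (@le_trans _ _ (t * (N * e))); last by rewrite ler_pM2l.
rewrite (_ : t * _ = a * N / (N * M) `^ p^-1); last first.
  by rewrite /t /a; ring.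
rewrite ler_pdivlMr// mul1r.
have pp0 : 0 < p - 1 by rewrite subr_gt0.
have MN : M <= a `^ p * N `^ (p - 1).
  have Map : 0 <= M / a `^ p by rewrite divr_ge0 ?powR_ge0// ltW.
  rewrite mulrC -ler_pdivrMr ?powR_gt0//.
  have -> : M / a `^ p = ((M / a `^ p) `^ (p - 1)^-1) `^ (p - 1).
    by rewrite -powRrM mulVf ?gt_eqF// powRr1.
  by apply: ge0_ler_powR; rewrite ?nnegrE ?powR_ge0// ltW.
have -> : a * N = ((a * N) `^ p) `^ p^-1.
  by rewrite -powRrM divff ?gt_eqF// powRr1// mulr_ge0// ltW.
have aN0 : 0 <= a * N by rewrite mulr_ge0// ltW.
apply: ge0_ler_powR; rewrite ?nnegrE ?powR_ge0//.
- exact: ltW.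
- by rewrite mulr_ge0// ltW.
rewrite (powRM _ (ltW a0) (ltW N0)) -(mulr_powRB1 (ltW N0) p0) mulrCA.
by rewrite ler_pM2l.
Qed.

(** The weights are arbitrary, so the support is cut simultaneously according to
the size of the weight and to that of the value of phi. *)
Lemma countable_support (phi : {scalar X}) : continuous (phi : X -> R) ->
  countable [set g | phi (unit_vector g) != 0].
Proof.
move=> phic; pose S (n : nat) :=
  [set g | (w g)%:num <= n%:R /\ n.+1%:R^-1 <= `|phi (unit_vector g)|].
apply: (@sub_countable _ _ _ (\bigcup_n S n)).
  apply: subset_card_le => g /= phig.
  exists (maxn (Num.truncn (w g)%:num).+1 (Num.truncn `|phi (unit_vector g)|^-1)) => //.
  split; first by rewrite (le_trans (ltW (truncnS_gt _)))// ler_nat leq_maxl.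
  rewrite invf_ple ?posrE ?normr_gt0// (le_trans (ltW (truncnS_gt _)))//.
  by rewrite ler_nat ltnS leq_maxr.
apply: bigcup_countable => // n _.
apply: finite_set_countable; apply: finite_large_values => //.
Qed.
End WeakNorm.

(** * Embeddings and cardinality of the index sets *)

Section Embedding.
Context {R : realType} {G1 G2 : choiceType}.
Variables (w1 : G1 -> {posnum R}) (w2 : G2 -> {posnum R}).
Variables (p r : R) (p1 : 1 < p) (r1 : 1 < r).
Let X := weaklType w1 p1.
Let Y := weaklType w2 r1.

Lemma unit_vector_neq0 g : unit_vector w1 p1 g != 0.
Proof.
apply/eqP => /(congr1 (coord g)); rewrite raddf0 /coord/= eqxx.
by move/eqP; rewrite oner_eq0.
Qed.

Lemma coord_neq0 (y : Y) : y != 0 -> exists g, coord g y != 0.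
Proof.
move=> y0; apply: contrapT => /forallNP yg; move/negP: y0; apply.
by apply/eqP/val_inj/funext => g; apply/eqP; apply: contrapT => /negP /yg.
Qed.

(** The functionals [coord h \o T] have countable supports, which cover G1 by
injectivity of T; numbering each of them embeds G1 into G2 * nat. *)
Lemma card_le_infinite (T : {linear X -> Y}) :
  infinite_set [set: G2] -> injective T -> continuous T ->
  ([set: G1] #<= [set: G2])%card.
Proof.
move=> G2inf Tinj Tcont.
pose supp h := [set g | coord h (T (unit_vector w1 p1 g)) != 0].
have /choice[idx idxP] h : exists f : G1 -> nat, {in supp h &, injective f}.
  apply/countable_injP; apply: (@countable_support _ _ w1 p p1 (coord h \o T)).
  move=> x; apply: continuous_comp; first exact: Tcont.
  exact: continuous_coord.
have /choice[h hP] g : exists h, supp h g.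
  apply: coord_neq0; rewrite -(raddf0 T).
  by apply/eqP => /Tinj/eqP; exact/negP/unit_vector_neq0.
apply: card_le_trans (infinite_card_prod_nat G2inf).
apply: (@injective_card_le _ _ (fun g => (h g, idx (h g) g))) => g g' [hg].
rewrite -hg; apply: idxP; apply: mem_set; first exact: hP.
by rewrite hg; exact: hP.
Qed.

(** The coordinates in B of the images of the unit vectors of A form a matrix
whose rows are linearly independent: a relation between them would be one
between the unit vectors themselves, as B indexes all coordinates and T is
injective. *)
Lemma leq_card_fset (T : {linear X -> Y}) (A : {fset G1}) (B : {fset G2}) :
  [set: G2] = [set` B] -> injective T -> (#|` A|%fset <= #|` B|%fset)%N.
Proof.
move=> BE Tinj.
pose a := tnth (in_tuple A); pose b := tnth (in_tuple B).
have ainj : injective a by apply/tuple_uniqP; exact: fset_uniq.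
pose M := \matrix_(i, j) coord (b j) (T (unit_vector w1 p1 (a i))).
suff /eqP <- : row_free M by exact: rank_leq_col.
rewrite -kermx_eq0; apply/rowV0P => v /sub_kermxP vM.
pose x : X := \sum_i v 0 i *: unit_vector w1 p1 (a i).
have x0 : x = 0.
  apply: Tinj; rewrite raddf0; apply/eqP; apply: contrapT => /negP/coord_neq0[h].
  move/eqP; apply.
  have /tnthP[j ->] : h \in in_tuple B by have : [set: G2] h by []; rewrite BE.
  rewrite /x !raddf_sum/=; transitivity ((v *m M) 0 j); last by rewrite vM mxE.
  by rewrite mxE; apply: eq_bigr => i _; rewrite linearZ mxE.
apply/rowP => i; rewrite mxE.
have := congr1 (coord (a i)) x0.
rewrite /x raddf_sum raddf0 (eq_bigr (fun k => v 0 k * (i == k)%:R)).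
  rewrite (bigD1 i)//= eqxx mulr1 big1 ?addr0// => k /negbTE.
  by rewrite eq_sym => ->; rewrite mulr0.
by move=> k _; rewrite -(inj_eq ainj).
Qed.

Lemma card_le_finite_dim (T : {linear X -> Y}) :
  finite_set [set: G2] -> injective T -> ([set: G1] #<= [set: G2])%card.
Proof.
move=> G2fin Tinj; have /finite_fsetP[B BE] := G2fin.
have G1fin : finite_set [set: G1].
  apply: contrapT => /(@infinite_set_fset _ _ #|` B|.+1)[A _].
  by rewrite ltnNge (leq_card_fset A BE Tinj).
have /finite_setP[m G1m] := G1fin; have /finite_setP[n G2n] := G2fin.
rewrite (card_le_eql G1m) (card_le_eqr G2n) card_le_II.
rewrite -(card_fset_set G1m) -(card_fset_set G2n).
by apply: leq_card_fset Tinj; rewrite fset_setK.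
Qed.

Lemma card_le_embedding (T : {linear X -> Y}) :
  injective T -> continuous T -> ([set: G1] #<= [set: G2])%card.
Proof.
move=> Tinj Tcont; have [G2fin|G2inf] := pselect (finite_set [set: G2]).
  exact: card_le_finite_dim Tinj.
exact: card_le_infinite Tcont.
Qed.

End Embedding.

Theorem theorem11 (R : realType) (G1 G2 : choiceType)
    (w1 : G1 -> {posnum R}) (w2 : G2 -> {posnum R})
    (p r : R) (p1 : 1 < p) (r1 : 1 < r) :
  ~ ([set: G1] #= [set: G2])%card ->
  ~ isomorphic (weaklType w1 p1) (weaklType w2 r1).
Proof.
move=> G12 [f [g [fK gK fcont gcont]]]; apply: G12.
pose glin := GRing.isLinear.Build R _ _ _ g (can2_linear fK gK).
pose g' : {linear weaklType w2 r1 -> weaklType w1 p1} := HB.pack g glin.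
rewrite card_eq_le (card_le_embedding (can_inj fK) fcont).
exact: (card_le_embedding (T := g') (can_inj gK) gcont).
Qed.
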